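(* Let $n\in\mathbb{N}$, let $\mathbb{K}\in\{\mathbb{R},\mathbb{C}\}$, and let $B_s=\mathrm{diag}(\lambda_1,\dots,\lambda_n)$ be a diagonal matrix with entries $\lambda_1,\dots,\lambda_n\in\mathbb{K}$. Let $I\subseteq\mathbb{K}[[x]]$ be an $L_{B_s}$-invariant ideal. Then $I$ can be generated by semi-invariants of $B_s$, i.e. there exist $m$ and $\varphi_1,\dots,\varphi_m\in\mathbb{K}[[x]]$ such that (a) $I=\langle\varphi_1,\dots,\varphi_m\rangle_{\mathbb{K}[[x]]}$; (b) for all $1\le j\le m$ there exists $\nu_j\in\mathbb{K}[x]$ with $L_{B_s}(\varphi_j)=\nu_j\cdot\varphi_j$.
   Context: $\mathbb{K}[[x]]=\mathbb{K}[[x_1,\dots,x_n]]$ is the ring of formal power series and $\mathbb{K}[x]=\mathbb{K}[x_1,\dots,x_n]$ the polynomial ring in $n$ variables. For a formal vector field $h=(h_1,\dots,h_n)\in\mathbb{K}[[x]]^n$ the Lie derivative is $L_h(\psi)=D\psi\cdot h=\sum_{i=1}^n h_i\,\partial\psi/\partial x_i$ for $\psi\in\mathbb{K}[[x]]$. For a matrix $A\in\mathbb{K}^{n\times n}$, $L_A$ denotes $L_h$ for the linear vector field $h(x)=Ax$; thus $L_{B_s}(\psi)=\sum_{i=1}^n\lambda_i x_i\,\partial\psi/\partial x_i$. An ideal $I\subseteq\mathbb{K}[[x]]$ is called $L_h$-invariant if $L_h(I)\subseteq I$. *)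

(* Defs.v *)
From HB Require Import structures.
From mathcomp Require Import all_boot all_order all_algebra.
From mathcomp Require Import boolp classical_sets reals.
From mathcomp Require Import complex.
From mathcomp Require Import mpoly.

Set Implicit Arguments.
Unset Strict Implicit.
Unset Printing Implicit Defensive.

Import GRing.Theory.

Local Open Scope ring_scope.
Local Open Scope classical_set_scope.

Variant ground_field := Real_field | Complex_field.

Definition scalars (R : realType) (k : ground_field) : fieldType :=
  match k with
  | Real_field => R
  | Complex_field => R[i]
  end.

(* The wrapper keeps the Cauchy product apart from the pointwise structures
   carried by plain functions. *)
Record fps (n : nat) (K : comNzRingType) :=
  FPS { fps_coef : 'X_{1..n} -> K }.

Notation "{ 'fps' K [ n ] }" := (fps n K)
  (at level 0, K at level 2, n at level 2, format "{ 'fps'  K [ n ] }")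
  : type_scope.

Section FpsRing.
Variables (n : nat) (K : comNzRingType).
Implicit Types (f g h : {fps K[n]}) (m : 'X_{1..n}) (p : {mpoly K[n]}).

Lemma fpsP f g : (forall m, fps_coef f m = fps_coef g m) -> f = g.
Proof. by case: f g => [f] [g] /= /funext ->. Qed.

HB.instance Definition _ := gen_eqMixin {fps K[n]}.
HB.instance Definition _ := gen_choiceMixin {fps K[n]}.

Definition fps_of_mpoly p : {fps K[n]} := FPS (fun m => p@_m).

Definition fps_add f g : {fps K[n]} :=
  FPS (fun m => fps_coef f m + fps_coef g m).
Definition fps_opp f : {fps K[n]} := FPS (fun m => - fps_coef f m).
Definition fps_scale (c : K) f : {fps K[n]} := FPS (fun m => c * fps_coef f m).

(* Same index set as in [mcoeffM]: the degree bounds only make the set of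
   pairs k with k.1 + k.2 = m a finite type. *)
Definition fps_mul f g : {fps K[n]} :=
  FPS (fun m =>
    \sum_(k : 'X_{1..n < (mdeg m).+1, (mdeg m).+1} | m == (k.1 + k.2)%MM)
      fps_coef f k.1 * fps_coef g k.2).

Fact fps_addA : associative fps_add.
Proof. by move=> f g h; apply: fpsP => m /=; rewrite addrA. Qed.
Fact fps_addC : commutative fps_add.
Proof. by move=> f g; apply: fpsP => m /=; rewrite addrC. Qed.
Fact fps_add0 : left_id (fps_of_mpoly 0) fps_add.
Proof. by move=> f; apply: fpsP => m /=; rewrite mcoeff0 add0r. Qed.
Fact fps_addN : left_inverse (fps_of_mpoly 0) fps_opp fps_add.
Proof. by move=> f; apply: fpsP => m /=; rewrite mcoeff0 addNr. Qed.

HB.instance Definition _ :=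
  GRing.isZmodule.Build {fps K[n]} fps_addA fps_addC fps_add0 fps_addN.

(* The ring laws are those of polynomials: a coefficient of a product only
   depends on truncations of the factors. *)
Definition fps_trunc d f : {mpoly K[n]} :=
  \sum_(m : 'X_{1..n < d}) fps_coef f m *: 'X_[m].

Lemma mcoeff_fps_trunc d f m :
  (mdeg m < d)%N -> (fps_trunc d f)@_m = fps_coef f m.
Proof. exact: (mcoeff_mpoly (fps_coef f)). Qed.

Lemma fps_coefM_mpoly d f g (p q : {mpoly K[n]}) m : (mdeg m < d)%N ->
  (forall m', (mdeg m' < d)%N -> fps_coef f m' = p@_m') ->
  (forall m', (mdeg m' < d)%N -> fps_coef g m' = q@_m') ->
  fps_coef (fps_mul f g) m = (p * q)@_m.
Proof.
move=> md fp gq; rewrite /= mcoeffM; apply: eq_bigr => k _.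
by rewrite fp ?gq //; apply: leq_trans md; apply: bmdeg.
Qed.

Fact fps_mulA : associative fps_mul.
Proof.
move=> f g h; apply: fpsP => m; pose d := (mdeg m).+1.
have tr u m' : (mdeg m' < d)%N -> fps_coef u m' = (fps_trunc d u)@_m'.
  by move=> ?; rewrite mcoeff_fps_trunc.
have trM u v m' : (mdeg m' < d)%N ->
    fps_coef (fps_mul u v) m' = (fps_trunc d u * fps_trunc d v)@_m'.
  by move=> md; apply: (fps_coefM_mpoly md); apply: tr.
by rewrite (fps_coefM_mpoly (ltnSn _) (tr f) (trM g h))
  (fps_coefM_mpoly (ltnSn _) (trM f g) (tr h)) mulrA.
Qed.

Fact fps_mulC : commutative fps_mul.
Proof.
move=> f g; apply: fpsP => m; pose d := (mdeg m).+1.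
have tr u m' : (mdeg m' < d)%N -> fps_coef u m' = (fps_trunc d u)@_m'.
  by move=> ?; rewrite mcoeff_fps_trunc.
by rewrite (fps_coefM_mpoly (ltnSn _) (tr f) (tr g))
  (fps_coefM_mpoly (ltnSn _) (tr g) (tr f)) mulrC.
Qed.

Fact fps_mul1 : left_id (fps_of_mpoly 1) fps_mul.
Proof.
move=> f; apply: fpsP => m.
rewrite (@fps_coefM_mpoly _ _ _ 1 (fps_trunc (mdeg m).+1 f) _ (ltnSn _)) //.
  by rewrite mul1r mcoeff_fps_trunc.
by move=> m' md; rewrite mcoeff_fps_trunc.
Qed.

Fact fps_mulDl : left_distributive fps_mul fps_add.
Proof.
move=> f g h; apply: fpsP => m /=; rewrite -big_split /=.
by apply: eq_bigr => k _; rewrite mulrDl.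
Qed.

Fact fps_oner_neq0 : fps_of_mpoly 1 != 0.
Proof.
apply/eqP => /(congr1 (fun f => fps_coef f 0%MM)) /=.
by rewrite mcoeff1 mcoeff0 eqxx => /eqP; rewrite oner_eq0.
Qed.

HB.instance Definition _ := GRing.Zmodule_isComNzRing.Build {fps K[n]}
  fps_mulA fps_mulC fps_mul1 fps_mulDl fps_oner_neq0.

Fact fps_scaleA a b f : fps_scale a (fps_scale b f) = fps_scale (a * b) f.
Proof. by apply: fpsP => m /=; rewrite mulrA. Qed.
Fact fps_scale1 : left_id 1 fps_scale.
Proof. by move=> f; apply: fpsP => m /=; rewrite mul1r. Qed.
Fact fps_scaleDr : right_distributive fps_scale +%R.
Proof. by move=> a f g; apply: fpsP => m /=; rewrite mulrDr. Qed.
Fact fps_scaleDl f : {morph fps_scale^~ f : a b / a + b}.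
Proof. by move=> a b; apply: fpsP => m /=; rewrite mulrDl. Qed.

HB.instance Definition _ := GRing.Zmodule_isLmodule.Build K {fps K[n]}
  fps_scaleA fps_scale1 fps_scaleDr fps_scaleDl.

Fact fps_scaleAl (a : K) f g : a *: (f * g) = (a *: f) * g.
Proof.
apply: fpsP => m /=; rewrite mulr_sumr.
by apply: eq_bigr => k _; rewrite mulrA.
Qed.

HB.instance Definition _ :=
  GRing.Lmodule_isLalgebra.Build K {fps K[n]} fps_scaleAl.
HB.instance Definition _ := GRing.Lalgebra_isComAlgebra.Build K {fps K[n]}.

Definition fps_deriv (i : 'I_n) f : {fps K[n]} :=
  FPS (fun m => fps_coef f (m + U_(i))%MM *+ (m i).+1).

Definition lie_derivative (h : 'I_n -> {fps K[n]}) f : {fps K[n]} :=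
  \sum_(i < n) h i * fps_deriv i f.

Definition linear_vector_field (A : 'M[K]_n) (i : 'I_n) : {fps K[n]} :=
  \sum_(j < n) A i j *: fps_of_mpoly 'X_j.

End FpsRing.

(* The ideals of ring_quotient are proper; here the unit ideal is allowed. *)
Definition is_ideal (A : comNzRingType) (I : set A) : Prop :=
  [/\ I 0, forall f g, I f -> I g -> I (f + g) & forall a f, I f -> I (a * f)].

Definition ideal_generated (A : comNzRingType) (m : nat) (phi : 'I_m -> A) :
    set A :=
  [set f | exists a : 'I_m -> A, f = \sum_(j < m) a j * phi j].

Definition lie_invariant (n : nat) (K : comNzRingType)
    (h : 'I_n -> {fps K[n]}) (I : set {fps K[n]}) : Prop :=
  lie_derivative h @` I `<=` I.

(* Main.v *)
(** [L] acts diagonally on monomials: [L x^v = <lambda, v> x^v].  Order the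
    monomials by degree, then lexicographically, and let the leading term of a
    series be its smallest one.  By Dickson's lemma finitely many leading
    monomials [x^(m_j)] of elements of [I] divide all the others, and formal
    division turns them into a reduced standard basis [g_j = x^(m_j) - r_j] of
    [I], where no term of [r_j] is divisible by any [x^(m_i)].  Then
    [L g_j - <lambda, m_j> g_j] lies in [I] and, as the term [x^(m_j)] cancels,
    has no term divisible by any [x^(m_i)]; so it is zero. *)
Require Import Defs.
From HB Require Import structures.
From mathcomp Require Import all_boot all_order all_algebra.
From mathcomp Require Import boolp classical_sets reals.
From mathcomp Require Import complex.
From mathcomp Require Import mpoly.

Set Implicit Arguments.
Unset Strict Implicit.
Unset Printing Implicit Defensive.

Local Open Scope ring_scope.
Local Open Scope classical_set_scope.

Import Order.TTheory GRing.Theory.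

(** * Dickson's lemma *)

(** Induction on the number of coordinates compared. Let [s] work for the first [d] coordinates and
    let [N] bound the last coordinate on [s]. Elements whose last coordinate is at least [N] are
    dominated by [s]; the others lie in the finitely many slices [f t d = k] with [k < N], and the
    induction hypothesis applies to each slice. *)
Lemma dickson (T : eqType) (f : T -> nat -> nat) (d : nat) (P : T -> Prop) :
  exists s : seq T, (forall t, t \in s -> P t) /\
    forall t, P t ->
      exists2 u, u \in s & forall i, (i < d)%N -> (f u i <= f t i)%N.
Proof.
elim: d P => [|d IHd] P.
  have [[t0 Pt0]|nP] := pselect (exists t, P t).
    exists [:: t0]; split=> [t|t _]; first by rewrite inE => /eqP ->.
    by exists t0; rewrite ?inE.
  by exists [::]; split=> [t|t Pt] //; case: nP; exists t.
have [s [sP sm]] := IHd P.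
pose N := (\max_(u <- s) f u d)%N.
have /choice[sk skP] k := IHd (fun t => P t /\ f t d = k).
exists (s ++ flatten (map sk (iota 0 N))); split=> [t|t Pt].
  rewrite mem_cat => /orP[/sP //|/flattenP[_ /mapP[k _ ->]]].
  by have [skk _] := skP k => /skk[].
have [leNt|ltNt] := leqP N (f t d).
  have [u us ut] := sm t Pt; exists u; first by rewrite mem_cat us.
  move=> i; rewrite ltnS leq_eqVlt => /orP[/eqP ->|/ut //].
  by apply: leq_trans leNt; apply: leq_bigmax_seq.
have [skk /(_ t)[//|u us ut]] := skP (f t d).
exists u.
  rewrite mem_cat; apply/orP; right; apply/flattenP; exists (sk (f t d)) => //.
  by apply: map_f; rewrite mem_iota.
move=> i; rewrite ltnS leq_eqVlt => /orP[/eqP ->|/ut //].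
by have [_ ->] := skk _ us.
Qed.

Lemma dickson_mnm (n : nat) (P : 'X_{1..n} -> Prop) :
  exists (r : nat) (m : 'I_r -> 'X_{1..n}), (forall j, P (m j)) /\
    forall u, P u -> exists j, (m j <= u)%MM.
Proof.
have [s [sP sm]] := dickson (fun (u : 'X_{1..n}) i => nth 0%N u i) n P.
exists (size s), (tnth (in_tuple s)); split=> [j|u /sm[v /seq_tnthP[j ->] le_vu]].
  by apply: sP; apply: mem_tnth.
by exists j; apply/mnm_lepP => i; have := le_vu i (ltn_ord i); rewrite -!tnth_nth.
Qed.

(** * Coefficients of products and of the Lie derivative *)

Section FormalPowerSeries.
Variables (n : nat) (K : comNzRingType).
Implicit Types (f g h : {fps K[n]}) (u v : 'X_{1..n}).

Lemma fps_coefD f g v : fps_coef (f + g) v = fps_coef f v + fps_coef g v.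
Proof. by []. Qed.

Lemma fps_coefB f g v : fps_coef (f - g) v = fps_coef f v - fps_coef g v.
Proof. by []. Qed.

Lemma fps_coef0 v : @fps_coef n K 0 v = 0.
Proof. exact: mcoeff0. Qed.

Lemma fps_coefZ c f v : fps_coef (c *: f) v = c * fps_coef f v.
Proof. by []. Qed.

Lemma fps_coef_sum (J : Type) (s : seq J) (P : pred J) (F : J -> {fps K[n]}) v :
  fps_coef (\sum_(i <- s | P i) F i) v = \sum_(i <- s | P i) fps_coef (F i) v.
Proof.
by apply: (big_morph (fun f => fps_coef f v)) => [f g|]; rewrite ?fps_coef0.
Qed.

Lemma fps_coefM_eq0 f g v :
  (forall k l, (k + l)%MM = v -> fps_coef f k * fps_coef g l = 0) ->
  fps_coef (f * g) v = 0.
Proof. by move=> fg0; apply: big1 => k /eqP e; apply: fg0. Qed.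

Lemma fps_coefM_unique f g k l :
  (forall k' l', (k' + l' = k + l)%MM -> k' != k ->
     fps_coef f k' * fps_coef g l' = 0) ->
  fps_coef (f * g) (k + l)%MM = fps_coef f k * fps_coef g l.
Proof.
move=> fg0.
have kP : (mdeg k < (mdeg (k + l)).+1)%N by rewrite ltnS mdegD leq_addr.
have lP : (mdeg l < (mdeg (k + l)).+1)%N by rewrite ltnS mdegD leq_addl.
rewrite [LHS]/= (bigD1 (BMultinom kP, BMultinom lP)) //= big1 ?addr0 //.
case=> k' l' /= /andP[/eqP e ne]; apply: fg0 => //.
apply: contra ne => /eqP e'; rewrite -pair_eqE /pair_eq /= !bmeqP /= e' eqxx /=.
by move: e; rewrite e' => /addmI/esym/eqP.
Qed.

Lemma fps_const_mul (c : K) f : fps_of_mpoly c%:MP * f = c *: f.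
Proof.
apply: fpsP => v; rewrite -[in LHS](add0m v) fps_coefM_unique.
  by rewrite /= mcoeffC eqxx mulr1.
by move=> k l _ k0 /=; rewrite mcoeffC (negbTE k0) mulr0 mul0r.
Qed.

Lemma fps_coef_euler (i : 'I_n) f v :
  fps_coef (fps_of_mpoly 'X_i * fps_deriv i f) v = fps_coef f v *+ v i.
Proof.
have [vi0|vi0] := boolP (U_(i) <= v)%MM.
  rewrite -(submK vi0); move: (v - _)%MM => w; rewrite addmC.
  rewrite fps_coefM_unique => [|k l _ ki].
    by rewrite /= mcoeffX eqxx mul1r mnmDE mnm1E eqxx [in LHS]addmC.
  by rewrite /= mcoeffX eq_sym (negbTE ki) mul0r.
(* Here [x_i] does not divide [x^v], so [v i = 0] and both sides vanish. *)
rewrite fps_coefM_eq0 => [|k l e].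
  by move: vi0; rewrite lep1mP negbK => /eqP ->.
rewrite /= mcoeffX; case: eqP => [ei|_]; last by rewrite mul0r.
by case/negP: vi0; rewrite -e -ei lem_addr.
Qed.

Lemma fps_coef_lie_diag (lambda : 'rV[K]_n) f v :
  fps_coef (lie_derivative (linear_vector_field (diag_mx lambda)) f) v =
  (\sum_(i < n) lambda 0 i *+ v i) * fps_coef f v.
Proof.
rewrite fps_coef_sum mulr_suml; apply: eq_bigr => i _.
have -> : linear_vector_field (diag_mx lambda) i =
    lambda 0 i *: fps_of_mpoly 'X_i.
  rewrite /linear_vector_field (bigD1 i) //= big1 ?addr0.
    by rewrite mxE eqxx mulr1n.
  by move=> j ji; rewrite mxE eq_sym (negbTE ji) mulr0n scale0r.
by rewrite -scalerAl fps_coefZ fps_coef_euler mulrnAr mulrnAl.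
Qed.

(** Well-founded recursion along the monomial order. Earlier values are extended by 0, so that [F]
    takes a total function, that is, the coefficients of a series. *)
Lemma mnm_recursion (F : 'X_{1..n} -> ('X_{1..n} -> K) -> K) :
  exists c : 'X_{1..n} -> K,
    forall v, c v = F v (fun u => if (u < v)%O then c u else 0).
Proof.
pose G v (rec : forall u, (u < v)%O -> K) :=
  F v (fun u => if @idP (u < v)%O is ReflectT uv then rec u uv else 0).
exists (Fix (@ltom_wf n) (fun _ => K) G) => v.
rewrite Fix_eq => [|w a b ab].
  by congr F; apply/funext => u; case: {-}_ / idP => [->|/negP/negbTE ->].
by congr F; apply/funext => u; case: {-}_ / idP.
Qed.

Definition has_lead f v :=
  fps_coef f v = 1 /\ forall u, (u < v)%O -> fps_coef f u = 0.

(** * Formal division by series with prescribed leading monomials *)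

Section Division.
Variables (r : nat) (m : 'I_r -> 'X_{1..n}) (h : 'I_r -> {fps K[n]}).

(* Only the first j with m j dividing v is used to cancel the term x^v. *)
Let divisor v : option 'I_r := [pick j | (m j <= v)%MM].

(** The sum of [c u * x^(u - m j)] over the exponents [u] assigned to [j] by [divisor]. *)
Let quotient (c : 'X_{1..n} -> K) (j : 'I_r) : {fps K[n]} :=
  FPS (fun k => if divisor (k + m j)%MM == Some j then c (k + m j)%MM else 0).

Let combination c := \sum_(j < r) quotient c j * h j.

Let combinationD c1 c2 :
  combination (fun u => c1 u + c2 u) = combination c1 + combination c2.
Proof.
rewrite -big_split; apply: eq_bigr => j _.
rewrite -[RHS](mulrDl (quotient c1 j)); congr (_ * _).
by apply: fpsP => k /=; case: ifP => _ //; rewrite addr0.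
Qed.

Hypothesis h_lead : forall j, has_lead (h j) (m j).

Let combination_lead c v j :
    (forall u, (u < v)%O -> c u = 0) -> (m j <= v)%MM ->
  fps_coef (combination c) v = c v.
Proof.
move=> c0 mjv; have [j0 divj0 mj0v] :
    exists2 j0, divisor v = Some j0 & (m j0 <= v)%MM.
  by rewrite /divisor; case: pickP => [j0|/(_ j)/idP//]; exists j0.
(* If [l < m i], the coefficient of [h i] vanishes; if [l > m i], then [k + m i < v], where [c]
   vanishes. So only [l = m i] can contribute to [x^v]. *)
have low i k l : (k + l)%MM = v -> l != m i ->
    fps_coef (quotient c i) k * fps_coef (h i) l = 0.
  move=> e ne; have [lt_l|ge_l] := ltP l (m i).
    by have [_ ->] := h_lead i; rewrite ?mulr0.
  rewrite /=; case: ifP => _; last by rewrite mul0r.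
  by rewrite c0 ?mul0r // -e ltmc_add2r lt_neqAle eq_sym ne.
have coef_i i : (m i <= v)%MM -> fps_coef (quotient c i * h i) v =
    if divisor v == Some i then c v else 0.
  move=> miv; rewrite -{1}(submK miv) fps_coefM_unique => [|k l e ne].
    by have [-> _] := h_lead i; rewrite mulr1 /= submK.
  apply: low; first by rewrite e submK.
  by apply: contra ne => /eqP el; move: e; rewrite el => /addIm ->.
have -> : fps_coef (combination c) v =
    \sum_(i < r) fps_coef (quotient c i * h i) v by exact: fps_coef_sum.
rewrite (bigD1 j0) // coef_i // divj0 eqxx big1 => [|i ij0]; first exact: addr0.
have [miv|miv] := boolP (m i <= v)%MM.
  rewrite coef_i // divj0.
  by case: eqP => // -[/eqP]; rewrite eq_sym (negbTE ij0).
apply: fps_coefM_eq0 => k l e; apply: low => //.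
by apply: contra miv => /eqP <-; rewrite -e lem_addl.
Qed.

Lemma fps_division f : exists a : 'I_r -> {fps K[n]},
  forall v j, (m j <= v)%MM -> fps_coef (f - \sum_(i < r) a i * h i) v = 0.
Proof.
(* [c v] is what remains of the coefficient of [f] at [v] after subtracting the contribution of the
   values of [c] below [v]. *)
have [c cE] := mnm_recursion
  (fun v c => fps_coef f v - fps_coef (combination c) v).
exists (quotient c) => v j mjv; rewrite fps_coefB -/(combination c).
(* The part [c1] below [v] is the one seen by the recursion; the part [c2] from [v] on contributes
   exactly [c v] at [v]. *)
pose c1 u := if (u < v)%O then c u else 0.
pose c2 u := if (u < v)%O then 0 else c u.
have -> : c = (fun u => c1 u + c2 u).
  by apply/funext => u; rewrite /c1 /c2; case: ifP; rewrite ?addr0 ?add0r.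
rewrite combinationD fps_coefD (@combination_lead c2 v j) //.
  by rewrite /c2 ltxx cE -/c1 [X in _ - X]addrC subrK subrr.
by move=> u uv; rewrite /c2 uv.
Qed.

End Division.
End FormalPowerSeries.

(** * Reduced standard bases of invariant ideals *)

Lemma ideal_sum (A : comNzRingType) (I : set A) (r : nat) (a h : 'I_r -> A) :
  is_ideal I -> (forall j, I (h j)) -> I (\sum_(j < r) a j * h j).
Proof. by case=> I0 ID IM Ih; apply: big_ind => // j _; apply: IM. Qed.

Lemma idealB (A : comNzRingType) (I : set A) f g :
  is_ideal I -> I f -> I g -> I (f - g).
Proof. by case=> _ ID IM If Ig; apply: ID => //; rewrite -mulN1r; apply: IM. Qed.

Section FieldCoefficients.
Variables (n : nat) (K : fieldType).
Implicit Types (f g h : {fps K[n]}) (u v : 'X_{1..n}).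

(** The monomial order is well-founded: without a least exponent in the support, induction makes
    every coefficient zero. *)
Lemma fps_neq0_lead f : f <> 0 -> exists v,
  fps_coef f v != 0 /\ has_lead ((fps_coef f v)^-1 *: f) v.
Proof.
move=> f0; apply: contrapT => nlead; apply: f0; apply: fpsP.
elim/(@ltmwf n) => v IHv.
rewrite fps_coef0; apply/eqP/negPn/negP => fv0.
apply: nlead; exists v; split=> //; split=> [|u uv].
  by rewrite fps_coefZ mulVf.
by rewrite fps_coefZ (IHv u uv) (fps_coef0 _ u) mulr0.
Qed.

Lemma ideal_semi_invariants (lambda : 'rV[K]_n) (I : set {fps K[n]}) :
    is_ideal I -> lie_invariant (linear_vector_field (diag_mx lambda)) I ->
  exists (r : nat) (phi : 'I_r -> {fps K[n]}) (w : 'I_r -> K),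
    I = ideal_generated phi /\
    forall j, lie_derivative (linear_vector_field (diag_mx lambda)) (phi j) =
      w j *: phi j.
Proof.
set L := lie_derivative _ => idI invI; have [I0 ID IM] := idI.
have IZ c f : I f -> I (c *: f) by rewrite -fps_const_mul; apply: IM.
have [r [m [mI mD]]] := dickson_mnm (fun v => exists2 f, I f & has_lead f v).
(* The leading monomial of a nonzero element of [I] is divisible by some [x^(m j)]. *)
have reduced0 f : I f -> (forall v j, (m j <= v)%MM -> fps_coef f v = 0) -> f = 0.
  move=> If red; apply: contrapT => /fps_neq0_lead[v [fv0 leadv]].
  have [|j /red/eqP] := mD v; last by rewrite (negbTE fv0).
  by exists ((fps_coef f v)^-1 *: f) => //; apply: IZ.
have /choice[h hP] j : exists f, I f /\ has_lead f (m j).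
  by have [f If fm] := mI j; exists f.
have /choice[a aP] j :=
  fps_division (fun i => (hP i).2) (fps_of_mpoly 'X_[m j]).
(* [g j] is [x^(m j)] minus its remainder under division by the [h i]. *)
pose g j := \sum_(i < r) a j i * h i.
have Ig j : I (g j) by apply: ideal_sum => // i; case: (hP i).
have g_red j v i : (m i <= v)%MM -> fps_coef (g j) v = (m j == v)%:R.
  by move=> /(aP j); rewrite fps_coefB /= mcoeffX => /eqP; rewrite subr_eq0 => /eqP.
(* The remainder might have terms below [m j]. But the leading exponent of [g j] lies above some
   [m i], and [m j] is the only such exponent in the support of [g j]. *)
have g_lead j : has_lead (g j) (m j).
  have gm : fps_coef (g j) (m j) = 1.
    by rewrite (g_red j _ j) ?eqxx ?lepm_refl.
  have [|v [gv0 leadv]] := @fps_neq0_lead (g j).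
    by move=> g0; move/eqP: gm; rewrite g0 fps_coef0 eq_sym oner_eq0.
  have [|i miv] := mD v; first by exists ((fps_coef (g j) v)^-1 *: g j);
    first exact: IZ.
  move: gv0 leadv; rewrite (g_red j v i) //.
  have [<- _|_] := eqVneq (m j) v; last by rewrite eqxx.
  by rewrite invr1 scale1r.
exists r, g, (fun j => \sum_(i < n) lambda 0 i *+ m j i); split=> [|j].
  apply/seteqP; split=> [f If|_ [b ->]]; last exact: ideal_sum.
  (* The remainder of [f] on division by the [g j] is reduced and lies in [I], hence is zero. *)
  have [b bP] := fps_division g_lead f; exists b; apply/eqP; rewrite -subr_eq0.
  by apply/eqP; apply: reduced0 bP; apply: idealB => //; apply: ideal_sum.
apply/eqP; rewrite -subr_eq0; apply/eqP; apply: reduced0.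
  by apply: idealB; [|apply: invI; exists (g j)|apply: IZ].
move=> v i miv; rewrite fps_coefB fps_coef_lie_diag fps_coefZ (g_red j v i) //.
by case: eqP => [->|_]; rewrite ?mulr0 subrr.
Qed.

End FieldCoefficients.

Theorem mainTheorem1 (R : realType) (k : ground_field) (n : nat)
    (lambda : 'rV[scalars R k]_n) (I : set {fps (scalars R k)[n]})
    (hI : is_ideal I)
    (hinv : lie_invariant (linear_vector_field (diag_mx lambda)) I) :
  exists (m : nat) (phi : 'I_m -> {fps (scalars R k)[n]}),
    I = ideal_generated phi /\
    (forall j : 'I_m, exists nu : {mpoly (scalars R k)[n]},
       lie_derivative (linear_vector_field (diag_mx lambda)) (phi j) =
       fps_of_mpoly nu * phi j).
Proof.
have [m [phi [w [genI semi]]]] := ideal_semi_invariants hI hinv.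
(* The cofactor is the constant polynomial given by the eigenvalue of [x^(m j)]. *)
exists m, phi; split=> // j; exists (w j)%:MP.
by rewrite fps_const_mul semi.
Qed.
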